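(* Let $H$ be a graph with vertex set $\{v_1,\dots,v_{n(H)}\}$, let $\mathcal{X}=\{X_i:1\le i\le n(H)\}$ be a family of graphs, each with at least one vertex, let $G=H\circ\mathcal{X}$, and let $F=\{v_i\in V(H):\mu(X_i)=\mu(v_i\circ X_i)\}$. Then $G$ is a $1$-König–Egerváry graph if and only if one of the following holds: (i) $H[F]=K_0$ (i.e. $F=\emptyset$), and exactly one of the $X_i$ is a $1$-König–Egerváry graph while all the others are König–Egerváry graphs; (ii) $H[F]=K_1$ and all $X_i$ are König–Egerváry graphs; (iii) $H[F]=K_2$ and all $X_i$ are König–Egerváry graphs.
   Context: All graphs are finite, simple and undirected. $n(G)$, $\alpha(G)$, $\mu(G)$ denote the number of vertices, independence number and maximum matching size. $G$ is König–Egerváry if $\alpha(G)+\mu(G)=n(G)$, and $1$-König–Egerváry if $\alpha(G)+\mu(G)=n(G)-1$. The corona $H\circ\mathcal{X}$ is obtained from the disjoint union of $H$ and $X_1,\dots,X_{n(H)}$ by joining each $v_i$ to all vertices of $X_i$; $v\circ X$ denotes $X$ plus a new vertex $v$ adjacent to all vertices of $X$. $H[F]$ is the subgraph of $H$ induced by $F$; $K_0$ is the graph with no vertices and $K_m$ the complete graph on $m$ vertices. *)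

(* Defs.v *)
From mathcomp Require Import all_boot.

Set Implicit Arguments.
Unset Strict Implicit.
Unset Printing Implicit Defensive.

Record sgraph := SGraph {
  vertex :> finType;
  adj : rel vertex;
  adj_sym : symmetric adj;
  adj_irrefl : irreflexive adj
}.

Definition iso (G H : sgraph) : Prop :=
  exists f : G -> H, bijective f /\ (forall x y, adj (f x) (f y) = adj x y).

Section Invariants.
Variable G : sgraph.

Definition edges : {set {set G}} :=
  [set [set p.1; p.2] | p : G * G & adj p.1 p.2].

Definition independent (S : {set G}) : bool :=
  [forall x in S, forall y in S, ~~ adj x y].

Definition matching (M : {set {set G}}) : bool :=
  (M \subset edges) && trivIset M.

Definition nvert : nat := #|G|.
Definition alpha : nat := \max_(S : {set G} | independent S) #|S|.
Definition mu : nat := \max_(M : {set {set G}} | matching M) #|M|.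

Definition KE : Prop := alpha + mu = nvert.

(* The "- 1" is moved to the left because subtraction on nat is truncated. *)
Definition KE1 : Prop := alpha + mu + 1 = nvert.

End Invariants.

Section Complete.
Variable m : nat.

Definition complete_adj : rel 'I_m := fun i j => i != j.

Lemma complete_sym : symmetric complete_adj.
Proof. by move=> i j; rewrite /complete_adj eq_sym. Qed.

Lemma complete_irrefl : irreflexive complete_adj.
Proof. by move=> i; rewrite /complete_adj eqxx. Qed.

Definition complete : sgraph := SGraph complete_sym complete_irrefl.

End Complete.

Notation "''K_' m" := (complete m) (at level 8, m at level 2, format "''K_' m").

Section Induced.
Variables (H : sgraph) (F : {set H}).

Definition induced_adj : rel {x : H | x \in F} := fun x y => adj (val x) (val y).

Lemma induced_sym : symmetric induced_adj.
Proof. by move=> x y; apply: adj_sym. Qed.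

Lemma induced_irrefl : irreflexive induced_adj.
Proof. by move=> x; apply: adj_irrefl. Qed.

Definition induced : sgraph := SGraph induced_sym induced_irrefl.

End Induced.

(* v o X: the new vertex v is [None]. *)
Section Cone.
Variable X : sgraph.

Definition cone_adj : rel (option X) := fun x y =>
  match x, y with
  | Some a, Some b => adj a b
  | None, None => false
  | _, _ => true
  end.

Lemma cone_sym : symmetric cone_adj.
Proof. by case=> [a|] [b|] //=; apply: adj_sym. Qed.

Lemma cone_irrefl : irreflexive cone_adj.
Proof. by case=> [a|] //=; apply: adj_irrefl. Qed.

Definition cone : sgraph := SGraph cone_sym cone_irrefl.

End Cone.

(* The family is indexed by the vertices of H. [inl v] is a vertex of H and
   [inr (Tagged _ a)] is the vertex a of X (tag _); [tagged_as p q] is the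
   second component of q cast to X (tag p), meaningful when the tags agree. *)
Section Corona.
Variables (H : sgraph) (X : H -> sgraph).

Definition corona_adj : rel (H + {v : H & X v}) := fun x y =>
  match x, y with
  | inl u, inl v => adj u v
  | inl u, inr q => u == tag q
  | inr p, inl v => tag p == v
  | inr p, inr q => (tag p == tag q) && adj (tagged p) (tagged_as p q)
  end.

Lemma corona_sym : symmetric corona_adj.
Proof.
case=> [u|[i a]] [v|[j b]] //=; [exact: adj_sym | exact: eq_sym.. |].
rewrite [j == i]eq_sym; case: eqP => //= eq_ij.
by move: b; case: j / eq_ij => b; rewrite !tagged_asE adj_sym.
Qed.

Lemma corona_irrefl : irreflexive corona_adj.
Proof. by case=> [u|[i a]] /=; rewrite ?tagged_asE adj_irrefl ?andbF. Qed.

Definition corona : sgraph := SGraph corona_sym corona_irrefl.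

End Corona.

(* Main.v *)
Require Import Defs.
From mathcomp Require Import all_boot.
From mathcomp Require Import zify.

(** Write d(G) = n(G) - alpha(G) - mu(G), which is never negative. In the corona,
    every vertex of H in an independent set can be traded for a vertex of its
    nonempty fibre, so alpha(G) is the sum of the alpha(X_v). A maximum matching
    of G may be taken to match each v outside F into its fibre, to leave the
    fibres over F to themselves and to match F inside H[F]; hence mu(G) is the sum
    of the mu(X_v) plus |V(H) \ F| + mu(H[F]). Therefore
    d(G) = sum d(X_v) + |F| - mu(H[F]), and as 2 mu(H[F]) <= |F| the last
    difference is 0 only for H[F] = K_0 and 1 only for H[F] = K_1 or K_2. *)

Set Implicit Arguments.
Unset Strict Implicit.
Unset Printing Implicit Defensive.

(** * Matchings and independent sets in a single graph *)

Section Matchings.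
Variable G : sgraph.
Implicit Types (S T e : {set G}) (M N : {set {set G}}).

Lemma edgesP e :
  reflect (exists x y, adj x y /\ e = [set x; y]) (e \in edges G).
Proof.
apply: (iffP imsetP) => [[[x y]]|[x [y [xy ->]]]].
  by rewrite inE /= => xy ->; exists x, y.
by exists (x, y); rewrite ?inE.
Qed.

Lemma card_edge e : e \in edges G -> #|e| = 2.
Proof.
case/edgesP=> x [y [xy ->]]; rewrite cards2; case: eqP => // eq_xy.
by move: xy; rewrite eq_xy adj_irrefl.
Qed.

Lemma edge_neq0 e : e \in edges G -> exists x, x \in e.
Proof. by case/edgesP=> x [y [_ ->]]; exists x; rewrite set21. Qed.

Lemma matching0 : @matching G set0.
Proof. by rewrite /matching sub0set; apply/trivIsetP => A B; rewrite inE. Qed.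

Lemma matching_edge M e : matching M -> e \in M -> e \in edges G.
Proof. by case/andP=> /subsetP sME _ /sME. Qed.

Lemma leq_mu M : matching M -> #|M| <= mu G.
Proof. by move=> mM; apply: (leq_bigmax_cond (F := fun N => #|N|)). Qed.

Lemma mu_witness : exists2 M : {set {set G}}, matching M & #|M| = mu G.
Proof.
have [|M mM eqM] := @eq_bigmax_cond _ (@matching G) (fun N => #|N|).
  by apply/card_gt0P; exists set0; apply: matching0.
by exists M => //; rewrite -eqM; apply: eq_bigl.
Qed.

(** The edges of [M] are disjoint, so a vertex of [T] determines the edge of [M] through it; hence
    [pblock M] sends [T] onto a family containing [N]. *)
Lemma leq_card_matching_hit M N T :
  matching M -> N \subset M -> {in N, forall e, exists2 x, x \in e & x \in T} ->
  #|N| <= #|T|.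
Proof.
case/andP=> _ tM /subsetP sNM hit.
apply: leq_trans (leq_imset_card (pblock M) T); apply/subset_leq_card/subsetP.
move=> e eN; have [x xe xT] := hit e eN.
by apply/imsetP; exists x => //; rewrite (def_pblock tM (sNM _ eN) xe).
Qed.

Lemma double_mu_leq : 2 * mu G <= #|G|.
Proof.
have [M mM <-] := mu_witness; have /andP[_ tM] := mM.
apply: leq_trans (max_card (mem (cover M))).
rewrite -[X in _ <= X]sum1_card big_trivIset // mulnC -sum_nat_const; apply: leq_sum => e eM.
by rewrite sum1_card (card_edge (matching_edge mM eM)).
Qed.

Lemma independentP S :
  reflect {in S &, forall x y, ~~ adj x y} (independent S).
Proof.
apply: (iffP forall_inP) => [iS x y xS yS|iS x xS].
  exact: (forall_inP (iS x xS)).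
by apply/forall_inP => y yS; apply: iS.
Qed.

Lemma leq_alpha S : independent S -> #|S| <= alpha G.
Proof. by move=> iS; apply: (leq_bigmax_cond (F := fun T => #|T|)). Qed.

Lemma alpha_witness : exists2 S : {set G}, independent S & #|S| = alpha G.
Proof.
have [|S iS eqS] := @eq_bigmax_cond _ (@independent G) (fun T => #|T|).
  by apply/card_gt0P; exists set0; apply/independentP => x y; rewrite inE.
by exists S => //; rewrite -eqS; apply: eq_bigl.
Qed.

Lemma alpha_gt0 : 0 < nvert G -> 0 < alpha G.
Proof.
case/card_gt0P=> x _; rewrite -(cards1 x); apply/leq_alpha/independentP.
by move=> y z /set1P-> /set1P->; rewrite adj_irrefl.
Qed.

(** An independent set contains no edge, so every edge of a matching hits its complement. *)
Lemma alpha_mu_leq : alpha G + mu G <= nvert G.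
Proof.
have [S iS <-] := alpha_witness; have [M mM <-] := mu_witness.
rewrite /nvert -(cardsC S) leq_add2l; apply: (leq_card_matching_hit mM) => //.
move=> e /(matching_edge mM)/edgesP[x [y [xy ->]]].
have [xS|xS] := boolP (x \in S); last by exists x; rewrite ?set21 ?inE.
exists y; rewrite ?set22 ?inE //; apply: contraL xy => yS.
exact: (independentP _ iS).
Qed.

(** The labelling [h] splits the vertices into classes and the edges of [M i] stay inside class [i],
    so edges with different indices are disjoint. As edges are nonempty, the families themselves are
    disjoint too and their sizes add up. *)
Lemma matching_bigcup (I : finType) (h : G -> I) (M : I -> {set {set G}}) :
  (forall i, matching (M i)) ->
  (forall i e x, e \in M i -> x \in e -> h x = i) ->
  matching (\bigcup_i M i) /\ #|\bigcup_i M i| = \sum_i #|M i|.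
Proof.
move=> mM hM; split.
  apply/andP; split.
    by apply/bigcupsP=> i _; have /andP[] := mM i.
  apply/trivIsetP => A B /bigcupP[i _ Ai] /bigcupP[j _ Bj] AB.
  have [eq_ij|ij] := eqVneq i j.
    move: Bj; rewrite -eq_ij => Bi; have /andP[_ /trivIsetP] := mM i.
    exact.
  apply/pred0P => x /=; apply/negP => /andP[/(hM _ _ _ Ai) hi /(hM _ _ _ Bj) hj].
  by move: ij; rewrite -hi -hj eqxx.
rewrite -sum1_card partition_disjoint_bigcup.
  by apply: eq_bigr => i _; rewrite sum1_card.
move=> i j ij; apply/pred0P => e /=; apply/negP => /andP[ei ej].
have [x xe] := edge_neq0 (matching_edge (mM i) ei).
by move: ij; rewrite -(hM _ _ _ ei xe) -(hM _ _ _ ej xe) eqxx.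
Qed.

End Matchings.

(** * Matchings carried along induced embeddings *)

Section Embeddings.
Variables (G K : sgraph) (f : G -> K).
Hypothesis f_inj : injective f.
Hypothesis f_adj : forall x y, adj (f x) (f y) = adj x y.

Lemma imset_set2 (x y : G) : f @: [set x; y] = [set f x; f y].
Proof. by rewrite imsetU1 imset_set1. Qed.

Lemma matching_imset (M : {set {set G}}) :
  matching M -> matching [set f @: (e : {set G}) | e in M].
Proof.
move=> mM; have /andP[_ tM] := mM; rewrite /matching imset_trivIset // tM andbT.
apply/subsetP => _ /imsetP[e /(matching_edge mM)/edgesP[x [y [xy ->]]] ->].
by apply/edgesP; exists (f x), (f y); rewrite f_adj imset_set2.
Qed.

Lemma card_matching_imset (M : {set {set G}}) :
  #|[set f @: (e : {set G}) | e in M]| = #|M|.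
Proof. by rewrite card_imset //; apply: imset_inj. Qed.

Lemma leq_mu_embedding : mu G <= mu K.
Proof.
have [M mM <-] := mu_witness G.
by rewrite -card_matching_imset; apply/leq_mu/matching_imset.
Qed.

Lemma leq_card_matching_sub (M : {set {set K}}) :
  matching M -> #|[set e in M | e \subset codom f]| <= mu G.
Proof.
move=> mM; have /andP[_ tM] := mM.
(* Pulling [M] back through images makes disjointness immediate from [imset_trivIset]. The members
   of [N] are edges because [f] also reflects adjacency. *)
pose N := [set A : {set G} | f @: A \in M].
have mN : matching N.
  apply/andP; split.
    apply/subsetP => A; rewrite inE => /(matching_edge mM)/edgesP[a [b [ab eqA]]].
    have /imsetP[x xA ax] : a \in f @: A by rewrite eqA set21.
    have /imsetP[y yA bY] : b \in f @: A by rewrite eqA set22.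
    apply/edgesP; exists x, y; rewrite -f_adj -ax -bY; split=> //.
    by apply: (imset_inj f_inj); rewrite imset_set2 eqA ax bY.
  rewrite -(imset_trivIset _ f_inj); apply: trivIsetS tM.
  by apply/subsetP => _ /imsetP[A AN ->]; rewrite inE in AN.
apply: leq_trans (leq_mu mN).
apply: leq_trans (leq_imset_card (fun A : {set G} => f @: A) N).
apply/subset_leq_card/subsetP => e; rewrite inE => /andP[eM /subsetP sef].
have def_e : e = f @: (f @^-1: e).
  apply/setP=> y; apply/idP/imsetP => [ye|[x]]; last by rewrite inE => xe ->.
  by have /codomP[x eq_y] := sef y ye; exists x; rewrite ?inE -?eq_y.
by apply/imsetP; exists (f @^-1: e); rewrite ?inE -?def_e.
Qed.

End Embeddings.

Lemma leq_card_bigcup (I T : finType) (A : I -> {set T}) :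
  #|\bigcup_i A i| <= \sum_i #|A i|.
Proof.
elim/big_rec2: _ => [|i n B _ leBn]; first by rewrite cards0.
by apply: leq_trans (leq_card_setU _ _) _; rewrite leq_add2l.
Qed.

(** * Numerical criteria for the complete graphs on at most two vertices *)

Lemma iso_complete (G : sgraph) m :
  iso G 'K_m <-> #|G| = m /\ (forall x y : G, adj x y = (x != y)).
Proof.
split=> [[f [f_bij f_adj]]|[eq_m adjE]].
  split=> [|x y]; first by rewrite (bij_eq_card f_bij) card_ord.
  by rewrite -f_adj /= /complete_adj (bij_eq f_bij).
exists (fun x => cast_ord eq_m (enum_rank x)); split=> [|x y].
  exists (fun i => enum_val (cast_ord (esym eq_m) i)) => [x|i].
    by rewrite cast_ordK enum_rankK.
  by rewrite enum_valK cast_ordKV.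
by rewrite /= /complete_adj (inj_eq (@cast_ord_inj _ _ _)) (inj_eq enum_rank_inj).
Qed.

Lemma iso_K0 (G : sgraph) : iso G 'K_0 <-> #|G| = 0.
Proof.
rewrite iso_complete; split=> [[]//|G0]; split=> // x.
by have := fintype0 x G0.
Qed.

Lemma iso_K1 (G : sgraph) : iso G 'K_1 <-> #|G| = 1.
Proof.
rewrite iso_complete; split=> [[]//|G1]; split=> // x y.
have /fintype1P[z all_z] : #|G| == 1 by rewrite G1.
by rewrite (all_z x) (all_z y) eqxx adj_irrefl.
Qed.

Lemma iso_K2 (G : sgraph) : iso G 'K_2 <-> #|G| = 2 /\ mu G = 1.
Proof.
have adjM (x y : G) : adj x y -> 0 < mu G.
  move=> xy; rewrite -(cards1 [set x; y]); apply: leq_mu.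
  by rewrite /matching trivIset1 sub1set andbT; apply/edgesP; exists x, y.
rewrite iso_complete; split=> -[G2 adjE]; split=> //.
  have [x [y [_ _ xy]]] : exists x y : G, [/\ x \in G, y \in G & x != y].
    by apply/card_gt1P; rewrite G2.
  have := double_mu_leq G; have := adjM x y; rewrite adjE xy G2; lia.
have [M mM] := mu_witness G; rewrite adjE => /eqP/cards1P[e eqM].
have eE : e \in edges G by apply: matching_edge mM _; rewrite eqM set11.
(* The single matching edge has two vertices, hence is the whole vertex set. *)
have eT : e = setT.
  by apply/eqP; rewrite eqEcard subsetT cardsT G2 (card_edge eE).
have /edgesP[a [b [ab eq_e]]] := eE.
move=> x y; have [<-|xy] := eqVneq x y; first by rewrite adj_irrefl.
have inab z : z \in [set a; b] by rewrite -eq_e eT.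
by move: xy; have [->|->] := set2P (inab x); have [->|->] := set2P (inab y);
  rewrite ?eqxx ?ab // adj_sym ab.
Qed.

(** * Independence number and matching number of the corona *)

Section CoronaInvariants.
Variables (H : sgraph) (X : H -> sgraph).
Implicit Types v w : H.

Let G := corona X.
Let F : {set H} := [set v : H | mu (X v) == mu (cone (X v))].

(** These maps realize each cone as an induced subgraph of the corona, with the apex going to [v];
    the cones cover all vertices. *)
Definition cone_in v (x : cone (X v)) : corona X :=
  if x is Some a then inr (Tagged X a) else inl v.

Lemma cone_in_inj v : injective (@cone_in v).
Proof.
case=> [a|] [b|] //= [] eq_ab.
by congr Some; move/eqP: eq_ab; rewrite eq_Tagged => /eqP.
Qed.

Lemma cone_in_adj v x y : adj (@cone_in v x) (cone_in y) = adj x y.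
Proof. by case: x y => [a|] [b|]; rewrite /= ?eqxx ?tagged_asE ?adj_irrefl. Qed.

Definition fibre_in v : X v -> corona X := cone_in (v := v) \o some.

Lemma fibre_in_inj v : injective (@fibre_in v).
Proof. exact: inj_comp (@cone_in_inj v) (@Some_inj _). Qed.

Lemma fibre_in_adj v x y : adj (@fibre_in v x) (fibre_in y) = adj x y.
Proof. exact: cone_in_adj. Qed.

Definition base_in (A : {set H}) (x : induced A) : corona X := inl (val x).

Lemma base_in_inj (A : {set H}) : injective (@base_in A).
Proof. by move=> x y [] /val_inj. Qed.

Lemma base_in_adj (A : {set H}) x y : adj (@base_in A x) (base_in y) = adj x y.
Proof. by []. Qed.

Lemma nvert_corona : nvert G = #|H| + \sum_v nvert (X v).
Proof.
rewrite /nvert card_sum; congr (_ + _); rewrite card_tagged sumnE big_map.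
by rewrite big_enum.
Qed.

Lemma alpha_corona :
  (forall v, 0 < nvert (X v)) -> alpha G = \sum_v alpha (X v).
Proof.
move=> X_gt0; apply/eqP; rewrite eqn_leq; apply/andP; split.
  have [S iS <-] := alpha_witness G; have /independentP iSP := iS.
  pose C v := [set z in S | z \in codom (@cone_in v)].
  have sSC : S \subset \bigcup_v C v.
    apply/subsetP => z zS; apply/bigcupP.
    case: z zS => [v|[v a]] zS; exists v; rewrite // inE zS /=.
      by apply/codomP; exists None.
    by apply/codomP; exists (Some a).
  apply: leq_trans (subset_leq_card sSC) (leq_trans (leq_card_bigcup _) _).
  (* If [v] is in [S], nothing else of its cone is, and the nonempty fibre has independence number
     at least 1. Otherwise [S] meets the cone only in the fibre. *)
  apply: leq_sum => v _; have [vS|vS] := boolP (inl v \in S).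
    apply: leq_trans (alpha_gt0 (X_gt0 v)); rewrite -(cards1 (inl v : G)).
    apply/subset_leq_card/subsetP => z.
    rewrite [z \in C v]inE => /andP[zS /codomP[[a|] def_z]].
      by have := iSP _ _ vS zS; rewrite def_z /= eqxx.
    by rewrite def_z inE.
  have iT : independent (@fibre_in v @^-1: S).
    by apply/independentP => x y; rewrite !inE -fibre_in_adj; apply: iSP.
  apply: leq_trans (leq_alpha iT).
  apply: leq_trans (leq_imset_card (@fibre_in v) _).
  apply/subset_leq_card/subsetP => z.
  rewrite [z \in C v]inE => /andP[zS /codomP[[a|] def_z]].
    by apply/imsetP; exists a; rewrite // inE -[fibre_in a]/(cone_in (Some a)) -def_z.
  by move: vS; rewrite -[inl v]/(@cone_in v None) -def_z zS.
have [S iS cS] := fin_all_exists2 (fun v => alpha_witness (X v)).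
(* No edge joins two different fibres, so maximum independent sets of the fibres can be united. *)
pose T := \bigcup_v (@fibre_in v @: S v).
have <- : #|T| = \sum_v alpha (X v).
  rewrite -sum1_card partition_disjoint_bigcup => [|v w vw].
    apply: eq_bigr => v _; rewrite sum1_card card_imset ?cS //.
    exact: fibre_in_inj.
  apply/pred0P=> z /=; apply/negP=> /andP[/imsetP[a _ ->] /imsetP[b _ [eq_vw]]].
  by move=> _; rewrite eq_vw eqxx in vw.
apply/leq_alpha/independentP => z t /bigcupP[v _ /imsetP[a aS ->]].
case/bigcupP=> w _ /imsetP[b bS ->].
have [eq_vw|vw] := eqVneq v w; last by rewrite /= (negPf vw).
case: w / eq_vw b bS => b bS; rewrite fibre_in_adj.
exact: (independentP _ (iS v)).
Qed.

(** The three terms bound three kinds of edges of a maximum matching: [C v] holds those inside the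
    cone (for [v] in [F]) or the fibre (otherwise), [A] those touching a base vertex outside [F],
    and [B] those inside [F]. *)
Lemma mu_corona_leq :
  mu G <= (\sum_v mu (X v)) + #|~: F| + mu (induced F).
Proof.
have [M mM <-] := mu_witness G.
pose A := [set e in M | [exists v in ~: F, inl v \in e]].
pose B := [set e in M | e \subset codom (@base_in F)].
pose C v := if v \in F then [set e in M | e \subset codom (@cone_in v)]
            else [set e in M | e \subset codom (@fibre_in v)].
have sM : M \subset (\bigcup_v C v) :|: A :|: B.
  apply/subsetP => e eM; rewrite !in_setU.
  have [eA|eA] := boolP (e \in A); first by rewrite orbT.
  have inF v : inl v \in e -> v \in F.
    move=> ve; apply: contraR eA => vF; rewrite inE eM.
    by apply/existsP; exists v; rewrite inE vF.
  have baseP v : v \in F -> (inl v : G) \in codom (@base_in F).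
    by move=> vF; apply/codomP; exists (exist _ v vF).
  have fibP v (a : X v) : inr (Tagged X a) \in codom (@fibre_in v).
    by apply/codomP; exists a.
  have inlP v : inl v \in codom (@cone_in v) by apply/codomP; exists None.
  have inrP v (a : X v) : inr (Tagged X a) \in codom (@cone_in v).
    by apply/codomP; exists (Some a).
  have sub2 (T : {pred G}) x y : x \in T -> y \in T -> [set x; y] \subset T.
    by move=> xT yT; apply/subsetP => z /set2P[] ->.
  have CP v : (v \in F -> e \subset codom (@cone_in v)) ->
      (v \notin F -> e \subset codom (@fibre_in v)) -> e \in \bigcup_v C v.
    move=> inC inX; apply/bigcupP; exists v; rewrite // /C.
    by case: (boolP (v \in F)) => vF; rewrite inE eM ?inC ?inX.
  have /edgesP[x [y [xy def_e]]] := matching_edge mM eM.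
  have xe : x \in e by rewrite def_e set21.
  have ye : y \in e by rewrite def_e set22.
  (* Any base vertex of [e] is now in [F], since [e] is not in [A]. So a base edge lies in [B], a
     mixed edge in the cone over a vertex of [F], and a fibre edge in its own [C v]. *)
  case: x y => [v|[v a]] [w|[w b]] /= in xy def_e xe ye *.
  - by rewrite inE eM def_e sub2 ?orbT ?baseP ?inF.
  - have vF := inF _ xe; rewrite (CP v) // => [_|]; last by rewrite vF.
    by rewrite def_e (eqP xy); apply: sub2; [apply: inlP | apply: inrP].
  - have wF := inF _ ye; rewrite (CP w) // => [_|]; last by rewrite wF.
    by rewrite def_e -(eqP xy); apply: sub2; [apply: inrP | apply: inlP].
  case/andP: xy => /eqP eq_vw _; rewrite (CP v) // => _; rewrite def_e;
    by case: w / eq_vw b {def_e ye} => b; apply: sub2;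
    (exact: inrP || exact: fibP).
apply: leq_trans (subset_leq_card sM) _.
apply: leq_trans (leq_card_setU _ _) (leq_add _ _).
  apply: leq_trans (leq_card_setU _ _) (leq_add _ _).
    apply: leq_trans (leq_card_bigcup _) _; apply: leq_sum => v _; rewrite /C.
    case: ifP => [|_]; last first.
      exact: (leq_card_matching_sub (@fibre_in_inj v) (@fibre_in_adj v) mM).
    (* Membership in [F] is what allows the whole cone to be charged to [mu (X v)]. *)
    rewrite inE => /eqP->.
    exact: (leq_card_matching_sub (@cone_in_inj v) (@cone_in_adj v) mM).
  rewrite -(card_imset (mem (~: F)) (inl_inj : injective (inl : H -> G))).
  apply: leq_card_matching_hit mM _ _.
    by apply/subsetP => e; rewrite inE => /andP[].
  move=> e; rewrite inE => /andP[_ /existsP[v /andP[vF ve]]].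
  by exists (inl v); rewrite ?imset_f.
exact: (leq_card_matching_sub (@base_in_inj F) (@base_in_adj F) mM).
Qed.

Lemma mu_corona_geq :
  (\sum_v mu (X v)) + #|~: F| + mu (induced F) <= mu G.
Proof.
(* The boolean [v \notin F] counts as one extra edge outside [F]; over [F] the apex stays free for a
   matching of [induced F]. *)
have /fin_all_exists[N NP] v : exists N : {set {set cone (X v)}},
    [/\ matching N, mu (X v) + (v \notin F) <= #|N|
      & v \in F -> forall e, e \in N -> None \notin e].
  have some_inj : injective (Some : X v -> cone (X v)) by move=> x y [].
  have some_adj (x y : X v) : adj (Some x : cone (X v)) (Some y) = adj x y by [].
  have [vF|vF] := boolP (v \in F).
    have [N mN cN] := mu_witness (X v).
    exists [set (Some : X v -> cone (X v)) @: (e : {set _}) | e in N].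
    split; first exact: (matching_imset some_inj some_adj mN).
      by rewrite addn0 -cN card_matching_imset.
    by move=> _ _ /imsetP[e _ ->]; apply/imsetP => -[].
  have [N mN cN] := mu_witness (cone (X v)); exists N; split=> //.
  (* The fibre embeds in its cone, so outside [F] the two matching numbers differ by at least
     one. *)
  have := leq_mu_embedding some_inj some_adj.
  by move: vF; rewrite inE cN; lia.
have [mN cN fN] := all_and3 NP; have [B mB cB] := mu_witness (induced F).
(* Label [None] collects the base vertices in [F]; label [Some v] collects the fibre of [v],
   together with [v] itself when [v] is outside [F]. *)
pose h (z : G) : option H := match z with
  | inl v => if v \in F then None else Some v
  | inr p => Some (tag p)
  end.
pose M i : {set {set G}} := if i is Some v
  then [set @cone_in v @: (e : {set _}) | e in N v]
  else [set @base_in F @: (e : {set _}) | e in B].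
have [||mM cM] := @matching_bigcup G _ h M.
- case=> [v|]; first exact: (matching_imset (@cone_in_inj v) (@cone_in_adj v)).
  exact: (matching_imset (@base_in_inj F) (@base_in_adj F) mB).
- case=> [v|] _ z /imsetP[e eN ->] /imsetP[x xe ->] /=; last by rewrite (valP x).
  case: x xe => //= xe; case: ifP => // vF.
  by have := fN v vF e eN; rewrite xe.
apply: leq_trans (leq_mu mM); rewrite cM (bigD1 None) //= addnC leq_add //.
  by rewrite /M (card_matching_imset (@base_in_inj F)) cB.
rewrite (reindex_omap Some id) => [|[]//] /=.
rewrite -[#|~: F|]sum1_card [\sum_(v in ~: F) _]big_mkcond -big_split.
rewrite [leqRHS](eq_bigl predT) => [|v]; last by rewrite /= eqxx.
apply: leq_sum => v _ /=.
rewrite /M (card_matching_imset (@cone_in_inj v)).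
by apply: leq_trans (cN v); rewrite inE; case: (v \in F).
Qed.

Lemma mu_corona : mu G = (\sum_v mu (X v)) + #|~: F| + mu (induced F).
Proof. by apply/eqP; rewrite eqn_leq mu_corona_leq mu_corona_geq. Qed.

End CoronaInvariants.

(** * Comparison of the deficiencies of the corona and of its fibres *)

Theorem theorem2p10 (H : sgraph) (X : H -> sgraph)
    (X_nonempty : forall v : H, 0 < nvert (X v)) :
  let G : sgraph := corona X in
  let F : {set H} := [set v : H | mu (X v) == mu (cone (X v))] in
  KE1 G <->
  [\/ iso (induced F) 'K_0 /\
        (exists v : H, KE1 (X v) /\ (forall w : H, w <> v -> KE (X w))),
      iso (induced F) 'K_1 /\ (forall v : H, KE (X v))
    | iso (induced F) 'K_2 /\ (forall v : H, KE (X v))].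
Proof.
move=> G F.
have cF : #|induced F| = #|F| by rewrite card_sig; apply: eq_card.
have := double_mu_leq (induced F); rewrite cF => le2mu.
(* The truncated subtraction is exact by [alpha_mu_leq]. *)
pose d v := nvert (X v) - (alpha (X v) + mu (X v)).
have dE v : nvert (X v) = alpha (X v) + mu (X v) + d v.
  by rewrite subnKC ?alpha_mu_leq.
have KEd v : KE (X v) <-> d v = 0 by rewrite /KE dE; lia.
have KE1d v : KE1 (X v) <-> d v = 1 by rewrite /KE1 dE; lia.
have KEall : (forall v, KE (X v)) <-> \sum_v d v = 0.
  split=> [allKE|/eqP]; first by apply: big1 => v _; apply/KEd.
  by rewrite sum_nat_eq0 => /forallP d0 v; apply/KEd/eqP/d0.
have KE1one : (exists v, KE1 (X v) /\ (forall w, w <> v -> KE (X w))) <->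
    \sum_v d v = 1.
  split=> [[v [/KE1d dv allKE]]|/eqP/sum_nat_eq1[v [_ dv d0]]].
    by rewrite (bigD1 v) //= dv big1 // => w /eqP wv; apply/KEd/allKE.
  by exists v; split=> [|w /eqP wv]; [apply/KE1d | apply/KEd/d0].
have KE1G : KE1 G <-> mu (induced F) + 1 = #|F| + \sum_v d v.
  rewrite /KE1 /G nvert_corona alpha_corona // mu_corona -/F.
  rewrite (eq_bigr _ (fun v _ => dE v)) !big_split /= -(cardsC F); lia.
have := iso_K2 (induced F); have := iso_K1 (induced F).
have := iso_K0 (induced F); rewrite cF => K0 K1 K2.
split=> [/KE1G defG|caseF].
  have [F0|F1|F2] : [\/ #|F| = 0 /\ \sum_v d v = 1, #|F| = 1 /\ \sum_v d v = 0
      | (#|F| = 2 /\ mu (induced F) = 1) /\ \sum_v d v = 0].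
  (* Eliminating [mu (induced F)] between [defG] and [le2mu] bounds [#|F|] plus twice the sum of the
     [d v] by 2, which leaves only these cases. *)
  - have [F0|F_gt0] := posnP #|F|; first by constructor 1; lia.
    by have [F1|F_neq1] := eqVneq #|F| 1; [constructor 2 | constructor 3]; lia.
  - by constructor 1; split; [apply/K0; case: F0 | apply/KE1one; case: F0].
  - by constructor 2; split; [apply/K1; case: F1 | apply/KEall; case: F1].
  - by constructor 3; split; [apply/K2; case: F2 | apply/KEall; case: F2].
apply/KE1G; case: caseF => -[].
- by move=> /K0 F0 /KE1one d1; lia.
- by move=> /K1 F1 /KEall d0; lia.
- by move=> /K2 [F2 mu1] /KEall d0; lia.
Qed.
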